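(* Assume (SH). Let $x\in\operatorname{dom}f$ and let $0<\rho_t\le1$, $t\in T$, satisfy $\inf_{t\in T}\rho_tf_t(x)>-\infty$. Then \[ \partial f(x)\subset\bigcap_{\varepsilon>0}\overline{\operatorname{co}}\Big(\Big(\bigcup_{t\in T(x)}\partial_\varepsilon f_t(x)\Big)\cup\Big(\bigcup_{t\in T\setminus T(x)}\varepsilon\,\partial_\varepsilon(\rho_tf_t)(x)\Big)\Big). \] Moreover, if $f$ attains its minimum at $x$, this inclusion is an equality.
   Context: $X$ is a real separated locally convex space with dual $X^*$ carrying the weak$^*$ topology. $T$ is a nonempty index set, $\{f_t: t\in T\}$ are proper convex lsc functions $X\to\mathbb{R}\cup\{+\infty\}$, $f:=\sup_{t\in T}f_t$. $T(x):=\{t\in T: f_t(x)=f(x)\}$ (active indices). $\partial_\varepsilon g(x)=\{x^*:\ g(y)\ge g(x)+\langle x^*,y-x\rangle-\varepsilon\ \forall y\}$ if $g(x)\in\mathbb{R}$, $\varepsilon\ge0$ (empty otherwise), $\partial=\partial_0$; $\varepsilon A=\{\varepsilon a:a\in A\}$. $\overline{\operatorname{co}}$ is the weak$^*$-closed convex hull. (SH): $T$ is compact Hausdorff and $t\mapsto f_t(z)$ is upper semicontinuous on $T$ for each $z\in X$. *)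

(* Defs.v *)
From HB Require Import structures.
From mathcomp Require Import all_boot all_order all_algebra.
From mathcomp Require Import all_classical all_reals all_analysis.
Set Implicit Arguments. Unset Strict Implicit. Unset Printing Implicit Defensive.
Import Order.TTheory GRing.Theory Num.Theory.
Import numFieldNormedType.Exports.
Local Open Scope classical_set_scope.
Local Open Scope ring_scope.

Section defs.
Context {R : realType} {X : tvsType R}.

Definition dual : set (X -> R) :=
  [set l | (forall (a : R) (u v : X), l (a *: u + v) = a * l u + l v)
           /\ continuous l].

(* weak^* closedness of a subset of X^* (basic weak^* neighbourhoods of l:
   finitely many points s, radius e) *)
Definition wstar_closed (A : set (X -> R)) : Prop :=
  forall l, dual l ->
    (forall (s : seq X) (e : R), 0 < e ->
       exists2 a, A a & forall z, z \in s -> `|a z - l z| < e) ->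
    A l.

Definition dconvex (C : set (X -> R)) : Prop :=
  forall a b (lam : R), C a -> C b -> 0 <= lam <= 1 ->
    C (fun z => lam * a z + (1 - lam) * b z).

Definition wclco (A : set (X -> R)) : set (X -> R) :=
  [set l | dual l /\ forall C, C `<=` dual -> dconvex C -> wstar_closed C ->
                         A `<=` C -> C l].

Definition esubdiff (eps : R) (g : X -> \bar R) (x : X) : set (X -> R) :=
  [set xs | dual xs /\ g x \is a fin_num /\
     forall y, (g x + (xs (y - x)%R)%:E - eps%:E <= g y)%E].

Definition subdiff := esubdiff 0.

Definition scale_set (eps : R) (A : set (X -> R)) : set (X -> R) :=
  [set (fun z => eps * a z) | a in A].

Definition proper_fun (g : X -> \bar R) : Prop :=
  (forall y, g y != -oo%E) /\ exists y, g y != +oo%E.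
Definition convex_fun (g : X -> \bar R) : Prop :=
  forall (y z : X) (lam : R), 0 <= lam <= 1 ->
    (g (lam *: y + (1 - lam) *: z)%R <= lam%:E * g y + (1 - lam)%:E * g z)%E.
Definition lsc_fun (g : X -> \bar R) : Prop :=
  forall r : R, closed [set y | (g y <= r%:E)%E].

End defs.

Definition usc_fun {T : topologicalType} {R : realType} (h : T -> \bar R) : Prop :=
  forall r : R, closed [set t | (r%:E <= h t)%E].

Definition supf {R : realType} {X : Type} {T : Type} (F : T -> X -> \bar R)
  (x : X) : \bar R := ereal_sup [set F t x | t in [set: T]].
Definition active {R : realType} {X : Type} {T : Type} (F : T -> X -> \bar R)
  (x : X) : set T := [set t | F t x = supf F x].

(* Main.v *)
(* Let x* be a subgradient of f = sup_t f_t at x.  If x* were outside the closed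
   convex hull, some direction z would satisfy a(z) <= x*(z) - d for all a in the
   generating set.  Put M = x*(z) - d/2.  The sets
     {t | f_t(x + s z) >= f(x) + s M},  s > 0,
   are closed and nonempty, and by convexity they decrease as s decreases to 0,
   so by compactness one index t lies in all of them.  Either t is active, and
   then f_t has eps-subgradients a at x with a(z) arbitrarily close to M; or
   f_t(x) < f(x), and then convexity forces f_t = +oo on the whole open ray, so
   that the eps-subgradients of rho_t f_t are unbounded above in direction z.
   Both contradict the choice of z.  Conversely, for fixed y, the generating set
   with parameter eps lies in a half-space {a | a(y - x) <= f(y) - f(x) + O(eps)}
   when f is minimal at x. *)

Require Import Defs.
From HB Require Import structures.
From mathcomp Require Import all_boot all_order all_algebra.
From mathcomp Require Import all_classical all_reals all_analysis.
From mathcomp Require Import ring lra.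
Import Order.TTheory GRing.Theory Num.Theory.
Import numFieldNormedType.Exports.
Local Open Scope classical_set_scope.
Local Open Scope ring_scope.

Set Implicit Arguments. Unset Strict Implicit. Unset Printing Implicit Defensive.

(** * Linear functionals on a real vector space *)

Section linear_functional.
Context {R : realType} {X : lmodType R} {a : X -> R}.
Context (lina : forall k u v, a (k *: u + v) = k * a u + a v).

Lemma functional0 : a 0 = 0.
Proof. by have := lina (-1) 0 0; rewrite scaler0 addr0 mulN1r addNr. Qed.

Lemma functionalZ k u : a (k *: u) = k * a u.
Proof. by have := lina k u 0; rewrite !addr0 functional0 addr0. Qed.

Lemma functionalD u v : a (u + v) = a u + a v.
Proof. by have := lina 1 u v; rewrite scale1r mul1r. Qed.

Lemma functionalN u : a (- u) = - a u.
Proof. by rewrite -scaleN1r functionalZ mulN1r. Qed.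

Lemma functional_sum n (c : 'I_n -> R) (w : 'I_n -> X) :
  a (\sum_i c i *: w i) = \sum_i c i * a (w i).
Proof.
apply: (big_rec2 (fun x y => a x = y)); first exact: functional0.
by move=> i x y _ <-; exact: lina.
Qed.

End linear_functional.

(** * A Hahn-Banach theorem for convex epigraphs *)

Section hahn_banach.
Context {R : realType} {X : lmodType R}.
Implicit Types (D : X -> R -> Prop) (G : set (X * R)).

(** [D v c] plays the role of p(v) <= c for a convex function p; a relation lets p be infinite or an
    infimum that is not attained. *)
Definition convex_epigraph D := forall u v c d (l : R), 0 < l < 1 ->
  D u c -> D v d -> D (l *: u + (1 - l) *: v) (l * c + (1 - l) * d).

(** Partial functionals are kept as graphs, so that chains have unions as upper bounds;
    single-valuedness is not imposed but derived from domination. *)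
Definition linear_graph G := forall k u v s t,
  G (u, s) -> G (v, t) -> G (k *: u + v, k * s + t).

Definition dominated_graph D G := forall v t c, G (v, t) -> D v c -> t <= c.

Lemma linear_graph_at0 G v t : linear_graph G -> G (v, t) -> G (0, 0).
Proof.
move=> linG Gvt; have := linG (-1) _ _ _ _ Gvt Gvt.
by rewrite scaleN1r mulN1r !addNr.
Qed.

Lemma linear_graphZ G k v t : linear_graph G -> G (v, t) -> G (k *: v, k * t).
Proof.
move=> linG Gvt; have := linG k _ _ _ _ Gvt (linear_graph_at0 linG Gvt).
by rewrite !addr0.
Qed.

(* The interval of admissible values at [v] is nonempty because of the
   convexity of [D], applied to a point on either side of [G]. *)
Lemma dominated_graph_extend D G v : convex_epigraph D ->
    (forall u, exists l c, 0 < l /\ D (l *: u) c) ->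
    linear_graph G -> dominated_graph D G -> G (0, 0) ->
  exists G', [/\ linear_graph G', dominated_graph D G', G `<=` G' &
                 exists t, G' (v, t)].
Proof.
move=> cvxD absD linG domG G0.
(* Domination at [g - m *: v] forces the lower bounds in [L] on the value at [v]; domination at
   [g + l *: v] forces upper bounds. The value chosen is [sup L]. *)
pose L := [set r | exists m g s c,
  [/\ 0 < m, G (g, s), D (g - m *: v) c & r = (s - c) / m]].
have ubL l g s c : 0 < l -> G (g, s) -> D (g + l *: v) c ->
    ubound L ((c - s) / l).
  move=> l0 Ggs Dc _ [m [h [r [d [m0 Ghr Dd ->]]]]].
  have lm0 : 0 < l + m by rewrite addr_gt0.
  (* With this weight the multiples of [v] cancel, leaving a point over which [G] already has a
     value dominated by [D]. *)
  have k01 : 0 < m / (l + m) < 1.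
    by rewrite divr_gt0//= ltr_pdivrMr// mul1r ltrDr.
  have := cvxD _ _ _ _ _ k01 Dc Dd.
  have -> : 1 - m / (l + m) = l / (l + m) by field; rewrite gt_eqF.
  have -> : (m / (l + m)) *: (g + l *: v) + (l / (l + m)) *: (h - m *: v)
      = (m / (l + m)) *: g + (l / (l + m)) *: h.
    rewrite !scalerDr scalerN !scalerA addrACA -scalerBl.
    by rewrite (_ : _ - _ = 0) ?scale0r ?addr0//; field; rewrite gt_eqF.
  move=> /(domG _ _ _ (linG _ _ _ _ _ Ggs (linear_graphZ _ linG Ghr))) H.
  rewrite ler_pdivrMr// mulrAC ler_pdivlMr//.
  suff: (m * s + l * r) <= (m * c + l * d) by lra.
  move: H; rewrite -(ler_pM2r lm0) => H.
  by apply: le_trans (le_trans H _); rewrite le_eqVlt; apply/orP; left;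
    apply/eqP; field; rewrite gt_eqF.
have supL : has_sup L.
  split.
    have [l [c [l0 Dc]]] := absD (- v).
    exists ((0 - c) / l), l, 0, 0, c; split => //.
    by rewrite sub0r -scalerN.
  have [l [c [l0 Dc]]] := absD v.
  by exists ((c - 0) / l); apply: (ubL l 0) => //; rewrite add0r.
pose t := sup L.
exists [set p | exists g s k, G (g, s) /\ p = (g + k *: v, s + k * t)].
split.
- move=> k u w _ _ [g [s [m [Ggs [-> ->]]]]] [h [r [n [Ghr [-> ->]]]]].
  exists (k *: g + h), (k * s + r), (k * m + n); split; first exact: linG.
  by congr pair; [rewrite scalerDr scalerDl scalerA addrACA|ring].
- move=> u _ c [g [s [k [Ggs [-> ->]]]]] Dc.
  have [k0|k0|k0] := ltgtP k 0.
  + have : L ((s - c) / - k).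
      exists (- k), g, s, c; split => //; first by rewrite oppr_gt0.
      by rewrite scaleNr opprK.
    move=> /(ub_le_sup (proj2 supL)).
    rewrite -/t ler_pdivrMr ?oppr_gt0//; lra.
  + have : t <= (c - s) / k by apply: ge_sup (proj1 supL) _; exact: ubL Dc.
    rewrite ler_pdivlMr//; lra.
  + by move: Dc; rewrite k0 scale0r addr0 mul0r addr0; exact: domG.
- by move=> [g s] Ggs; exists g, s, 0; rewrite scale0r mul0r !addr0.
- by exists t, 0, 0, 1; rewrite scale1r mul1r !add0r.
Qed.

(** A maximal dominated linear graph is total by the one-step extension, and single-valued since a
    nonzero value over 0 could be scaled past any bound. *)
Lemma hahn_banach_epigraph D : convex_epigraph D ->
    (forall u, exists l c, 0 < l /\ D (l *: u) c) ->
    (forall c, D 0 c -> 0 <= c) ->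
  exists a : X -> R, (forall k u v, a (k *: u + v) = k * a u + a v) /\
    (forall v c, D v c -> a v <= c).
Proof.
move=> cvxD absD D0.
pose P G := linear_graph G /\ dominated_graph D G.
have [|G [[linG domG] maxG]] := @Zorn_bigcup (X * R)%type P.
  move=> H HP totH; split.
    move=> k u v s t [G1 HG1 G1u] [G2 HG2 G2v].
    have [sub|sub] := totH _ _ HG1 HG2.
      by exists G2 => //; apply: (proj1 (HP _ HG2)) => //; exact: sub.
    by exists G1 => //; apply: (proj1 (HP _ HG1)) => //; exact: sub.
  by move=> v t c [G1 HG1 G1v]; exact: (proj2 (HP _ HG1)) G1v.
have G0 : G (0, 0).
  (* A linear graph missing (0, 0) is empty, hence not maximal. *)
  apply: contrapT => nG0; apply: (maxG [set (0, 0)]).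
    split; last by move/(_ (0, 0) erefl).
    move=> [u s] Gus; exfalso; apply: nG0; exact: linear_graph_at0 Gus.
  split => [k u v s t [-> ->] [-> ->]|v t c [-> ->]]; last exact: D0.
  by rewrite /= scaler0 mulr0 !addr0.
have totG v : exists t, G (v, t).
  have [G' [linG' domG' GG' [t G't]]] :=
    dominated_graph_extend v cvxD absD linG domG G0.
  exists t; apply: contrapT => nGt; apply: (maxG G') => //.
  by split => // /(_ _ G't).
have zeroG s : G (0, s) -> s = 0.
  move=> Gs; have [l [c [l0 Dc]]] := absD 0; rewrite scaler0 in Dc.
  have le k : k * s <= c.
    by have := linear_graphZ k linG Gs; rewrite scaler0 => /domG; exact.
  apply: contrapT => /eqP s0.
  by have := le ((c + 1) / s); rewrite divfK//; lra.
have funG v s t : G (v, s) -> G (v, t) -> s = t.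
  move=> Gs Gt; have := linG (-1) _ _ _ _ Gs Gt.
  by rewrite scaleN1r mulN1r addNr => /zeroG; lra.
have [a aG] := choice totG.
exists a; split=> [k u v|v c]; last exact: domG.
exact: funG (aG _) (linG _ _ _ _ _ (aG _) (aG _)).
Qed.

End hahn_banach.

(** * Convex neighbourhoods, continuity and lower semicontinuity *)

Section convex_neighborhood.
Context {R : realType} {X : tvsType R}.

Definition convex_in (V : set X) := forall u v (l : R), 0 < l < 1 ->
  V u -> V v -> V (l *: u + (1 - l) *: v).

Lemma convex_nbhs0 (U : set X) : nbhs (0 : X) U ->
  exists V : set X, [/\ nbhs (0 : X) V, convex_in V & V `<=` U].
Proof.
move=> U0; have [B cvxB [opB /(_ 0 U U0) [V [BV V0] VU]]] := @locally_convex R X.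
exists V; split => //.
  by apply: open_nbhs_nbhs; split => //; exact: opB.
move=> u v l /andP[/ltW l0 /ltW l1] Vu Vv.
have := cvxB V (mem_set BV) u v (Itv01 l0 l1) (mem_set Vu) (mem_set Vv).
by move/set_mem.
Qed.

Lemma nbhs0_absorbing (U : set X) (v : X) : nbhs (0 : X) U ->
  exists2 l : R, 0 < l & U (l *: v).
Proof.
move=> U0.
have /= := @scale_continuous R X (0, v) U; rewrite scale0r => /(_ U0).
move=> [[A B] [/= A0 Bv] AB].
have [e /= e0 eA] := (nbhs_ballP _ _).1 A0.
exists (e / 2); first by rewrite divr_gt0.
apply: (AB (e / 2, v)); split => /=; last exact: nbhs_singleton.
apply: eA; rewrite -ball_normE /= sub0r normrN gtr0_norm ?divr_gt0//.
by rewrite ltr_pdivrMr// ltr_pMr// ltr1n.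
Qed.

(** Intersecting a small multiple of [V] with its opposite turns the one-sided bound into a
    two-sided one. *)
Lemma linear_le_nbhs_continuous (a : X -> R) (V : set X) (c : R) :
  (forall k u v, a (k *: u + v) = k * a u + a v) ->
  nbhs (0 : X) V -> (forall v, V v -> a v <= c) -> continuous a.
Proof.
move=> lina V0 aV x.
have c0 : 0 <= c by rewrite -(functional0 lina); apply: aV; exact: nbhs_singleton.
apply/cvgrPdist_le => /= e e0.
(* The denominator is [c + 1] because [c] may be 0. *)
have k0 : 0 < e / (c + 1) by rewrite divr_gt0// ltr_wpDl.
have kV := nbhs0Z (lt0r_neq0 k0) V0.
have kVN := nbhs0N kV.
apply: filterS (nbhsT x (filterI kV kVN)) => _ /= [w [[v Vv vw] [_ [u Vu <-] uw]] <-].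
have -> : a x - a (x + w) = - a w.
  by rewrite (functionalD lina) opprD addrA subrr add0r.
have ek : e / (c + 1) * c <= e.
  by rewrite mulrAC ler_pdivrMr ?ltr_wpDl// ler_pM2l// lerDl.
rewrite ler_norml; apply/andP; split.
  rewrite lerN2 -vw (functionalZ lina); apply: le_trans ek.
  by rewrite ler_pM2l// aV.
have -> : - a w = a (e / (c + 1) *: u).
  by rewrite -uw (functionalN lina) opprK.
by rewrite (functionalZ lina); apply: le_trans ek; rewrite ler_pM2l// aV.
Qed.

(** Compactness of [0, N] makes one neighbourhood serve all [s]. Half of [e] pays for lower
    semicontinuity, half for the variation of [s * M]. *)
Lemma lsc_tube (g : X -> \bar R) (x z : X) (r M N e : R) :
  lsc_fun g -> 0 < e ->
  (forall s, 0 <= s <= N -> ((r + s * M)%:E <= g (x + s *: z)%R)%E) ->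
  exists V : set X, [/\ nbhs (0 : X) V, convex_in V &
    forall s v, 0 <= s <= N -> V v ->
      ((r + s * M - e)%:E <= g (x + s *: z + v)%R)%E].
Proof.
move=> lscg e0 gM.
have e20 : 0 < e / 2 by rewrite divr_gt0.
pose P v s := ((r + s * M - e)%:E <= g (x + s *: z + v)%R)%E.
have nearP s : `[0, N]%classic s ->
    \forall s' \near s & v \near nbhs (0 : X), P v s'.
  move=> /=; rewrite in_itv/= => s0N.
  have opg : open [set y | ((r + s * M - e / 2)%:E < g y)%E].
    have -> : [set y | ((r + s * M - e / 2)%:E < g y)%E]
        = ~` [set y | (g y <= (r + s * M - e / 2)%:E)%E].
      by apply/seteqP; split => y /=; rewrite ltNge => /negP.
    by rewrite openC.
  have nbg : nbhs (x + s *: z + 0) [set y | ((r + s * M - e / 2)%:E < g y)%E].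
    rewrite addr0; apply: open_nbhs_nbhs; split => //=.
    apply: lt_le_trans (gM _ s0N); rewrite lte_fin ltrBlDr ltrDl divr_gt0//.
  have cts : continuous (fun p : R^o * X => (x + p.1 *: z) + p.2).
    move=> p.
    have scl : (fun q : R^o * X => q.1 *: z) @ p --> p.1 *: z.
      exact: (cvg_comp2 (h := fun (k : R^o) (v : X) => k *: v) cvg_fst
        (cvg_cst z) (@scale_continuous R X (p.1, z))).
    have add : (fun q : R^o * X => x + q.1 *: z) @ p --> x + p.1 *: z.
      exact: (cvg_comp2 (h := fun u v : X => u + v) (cvg_cst x) scl
        (@add_continuous X (x, p.1 *: z))).
    exact: (cvg_comp2 (h := fun u v : X => u + v) add cvg_snd
      (@add_continuous X (x + p.1 *: z, p.2))).
  have ctM : continuous (fun k : R => k * M).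
    by move=> k; apply: cvgMl; exact: cvg_id.
  have sM : \forall k \near s, k * M <= s * M + e / 2.
    have /cvgrPdist_le/(_ (e / 2)) := ctM s.
    move=> /(_ e20); apply: filterS => k.
    rewrite ler_norml => /andP[+ _]; lra.
  have [[A B] [/= sA B0] AB] := cts (s, 0) _ nbg.
  exists (A `&` [set k | k * M <= s * M + e / 2], B).
    by split => //=; exact: filterI.
  move=> [k v] /= [[Ak kM] Bv].
  have := AB (k, v) (conj Ak Bv); move=> /= /ltW; apply: le_trans.
  rewrite lee_fin; lra.
have := (compact_near_coveringP _).1 (@segment_compact R 0 N) X (nbhs (0 : X)) P
  (nbhs_filter _) nearP.
move=> /convex_nbhs0 [V [V0 cvxV VP]].
exists V; split => // s v s0N Vv.
by apply: (VP v Vv); rewrite /= in_itv.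
Qed.

End convex_neighborhood.

(** * Approximate subgradients with prescribed slope *)

Section esubdiff_direction.
Context {R : realType} {X : tvsType R}.

(** The segment of slope [M], lowered by [eps], can be separated from the epigraph; the room [eps]
    is what makes the separating functional continuous. *)
Lemma exists_esubdiff_ge (g : X -> \bar R) (x z : X) (eps M M' : R) :
  convex_fun g -> lsc_fun g -> (forall y, g y != -oo%E) ->
  g x \is a fin_num -> 0 < eps ->
  (forall s, 0 < s -> ((fine (g x) + s * M)%:E <= g (x + s *: z)%R)%E) ->
  M' < M -> exists2 a, esubdiff eps g x a & M' <= a z.
Proof.
move=> cvxg lscg gNy gx eps0 gM M'M.
(* Over a segment of length [N] the loss [eps] costs exactly [M - M'] in slope. *)
set N := eps / (M - M'); have N0 : 0 < N by rewrite divr_gt0// subr_gt0.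
set r0 := fine (g x); have gxE : g x = r0%:E by rewrite fineK.
have [s /andP[s0 _]|V [V0 cvxV gV]] := @lsc_tube R X g x z r0 M N eps lscg eps0.
  move: s0; rewrite le_eqVlt => /predU1P[<-|]; last exact: gM.
  by rewrite mul0r scale0r !addr0 gxE.
(* Hahn-Banach is applied to [V] minus the vertical differences between the
   epigraph of [g] and the segment above [x, x + N z] of slope [M] through
   (x, g x - eps). *)
pose D (v : X) (c : R) := exists w y s r,
  [/\ V w, 0 <= s <= N, (g y <= r%:E)%E, v = w + x + s *: z - y &
      c = r - r0 + eps - s * M].
(* This bound on [V] gives both the absorption hypothesis of Hahn-Banach and the continuity of
   [a]. *)
have Dx w : V w -> D w eps.
  move=> Vw; exists w, x, 0, r0; rewrite lexx ltW//; split => //.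
  - by rewrite gxE.
  - by rewrite scale0r addr0 addrK.
  - by rewrite mul0r subrr add0r subr0.
have Vz : V 0 by exact: nbhs_singleton.
have [||c [w [y [s [r [Vw s0N gyr /esym v0 ->]]]]]|a [lina aD]] :=
    @hahn_banach_epigraph R X D.
- move=> _ _ _ _ l l01 [w1 [y1 [s1 [r1 [V1 sN1 g1 -> ->]]]]]
    [w2 [y2 [s2 [r2 [V2 sN2 g2 -> ->]]]]].
  have /andP[l0 l1] := l01.
  exists (l *: w1 + (1 - l) *: w2), (l *: y1 + (1 - l) *: y2),
    (l * s1 + (1 - l) * s2), (l * r1 + (1 - l) * r2); split.
  + exact: cvxV.
  + by apply/andP; split; nra.
  + have l01' : 0 <= l <= 1 by rewrite !ltW.
    apply: le_trans (cvxg y1 y2 l l01') _.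
    rewrite [leRHS]EFinD (EFinM l) (EFinM (1 - l)); apply: leeD; apply: lee_wpmul2l => //;
      by rewrite lee_fin; lra.
  + rewrite !scalerDr !scalerN !scalerA addrACA -opprD; congr (_ - _).
    rewrite addrACA -scalerDl; congr (_ + _).
    by rewrite addrACA -scalerDl subrKC scale1r.
  + ring.
- move=> u; have [l l0 Vl] := nbhs0_absorbing u V0.
  by exists l, eps; split => //; exact: Dx.
(* Over 0, the point [y] lies in the tube around the segment, where [gV] bounds [g] from below. *)
- have yE : y = x + s *: z + w by apply/esym/eqP; rewrite addrC addrA -subr_eq0 v0.
  have := le_trans (gV s w s0N Vw) (le_trans _ gyr).
  by rewrite yE => /(_ (lexx _)); rewrite lee_fin; lra.
have cont_a : continuous a.
  by apply: (linear_le_nbhs_continuous lina V0) => v /Dx /aD; exact.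
exists (fun v => - a v).
  split; first split => //.
  - by move=> k u v; rewrite lina; ring.
  - by move=> v; apply: cvgN; exact: cont_a.
  split=> // y; rewrite gxE.
  case gyE : (g y) => [r| |]; last 2 first.
  - by rewrite leey.
  - by have := gNy y; rewrite gyE.
  have := aD (0 + x + 0 *: z - y) (r - r0 + eps - 0 * M).
  have D' : D (0 + x + 0 *: z - y) (r - r0 + eps - 0 * M).
    by exists 0, y, 0, r; rewrite lexx ltW// gyE.
  move=> /(_ D'); rewrite !(functionalD lina) !(functionalN lina)
    (functionalZ lina) (functional0 lina) lee_fin; lra.
(* The far end of the segment yields the slope estimate. *)
have D' : D (0 + x + N *: z - x) (r0 - r0 + eps - N * M).
  by exists 0, x, N, r0; rewrite lexx ltW// gxE.
have := aD _ _ D'; rewrite !(functionalD lina) (functionalN lina) (functionalZ lina)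
  (functional0 lina).
have -> : eps = N * (M - M') by rewrite /N divfK// subr_eq0 gt_eqF.
move=> H; have : N * a z <= N * - M' by lra.
by rewrite ler_pM2l//; lra.
Qed.

End esubdiff_direction.

(** * Separation from weak* closed convex sets *)

Section separation.
Context {R : realType} {X : tvsType R}.

(* Only the values on the finite list [s] matter, so the separation takes place
   in a finite-dimensional space. *)
Lemma dconvex_separation (C : set (X -> R)) (l : X -> R) (s : seq X) (e : R) :
  C `<=` dual -> dconvex C -> C !=set0 -> dual l -> 0 < e ->
  (forall a, C a -> exists2 z, z \in s & e <= `|a z - l z|) ->
  exists z, forall a, C a -> a z <= l z - e.
Proof.
move=> Cdual cvxC [a0 Ca0] [linl _] e0 Ce.
set n := size s; pose p (i : 'I_n) := nth 0 s i.
(* This encodes the sup-norm distance from [v] to the restrictions of [l - a], [a] in [C], minus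
   [e]; by [Ce] it is nonnegative at 0. *)
pose D (v : 'rV[R]_n) (c : R) := exists2 a, C a &
  forall i, `|v 0 i + (a (p i) - l (p i))| <= c + e.
have [|u|c [a Ca ac]|phi [linphi phiD]] := @hahn_banach_epigraph R 'rV[R]_n D.
- move=> u v c d k /andP[k0 k1] [a Ca ac] [b Cb bd].
  exists (fun z => k * a z + (1 - k) * b z).
    by apply: cvxC => //; rewrite !ltW.
  move=> i; rewrite !mxE.
  have -> : k * u 0 i + (1 - k) * v 0 i
      + (k * a (p i) + (1 - k) * b (p i) - l (p i)) =
    k * (u 0 i + (a (p i) - l (p i))) + (1 - k) * (v 0 i + (b (p i) - l (p i))).
    by ring.
  apply: le_trans (ler_normD _ _) _; rewrite !normrM (gtr0_norm k0).
  rewrite [`|1 - k|]gtr0_norm ?subr_gt0//.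
  have -> : k * c + (1 - k) * d + e = k * (c + e) + (1 - k) * (d + e) by ring.
  by apply: lerD; apply: ler_wpM2l => //; rewrite ?subr_ge0 ltW.
- pose B := \sum_i `|u 0 i + (a0 (p i) - l (p i))|.
  exists 1, B; split => //; exists a0 => // i; rewrite scale1r.
  apply: ler_wpDr; first exact: ltW.
  by rewrite /B (bigD1 i)//= lerDl sumr_ge0.
- have [z zs ez] := Ce _ Ca.
  have zn : (index z s < n)%N by rewrite index_mem.
  have := ac (Ordinal zn); rewrite mxE add0r /p/= nth_index// => ace.
  by have := le_trans ez ace; rewrite lerDr.
(* The vector representing [phi]: the value of [phi] at the restriction of [l - a] is
   [a z - l z]. *)
pose z := - \sum_i phi (delta_mx 0 i) *: p i.
have fz (f : X -> R) : (forall k u v, f (k *: u + v) = k * f u + f v) ->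
    f z = - \sum_i f (p i) * phi (delta_mx 0 i).
  move=> linf; rewrite (functionalN linf) (functional_sum linf).
  by congr (- _); apply: eq_bigr => i _; rewrite mulrC.
exists z => a Ca; have [lina _] := Cdual _ Ca.
have : phi (\row_i (l (p i) - a (p i))) <= - e.
  apply: phiD; exists a => // i; rewrite mxE.
  by rewrite addrC subrKA subrr normr0 addNr.
rewrite [X in phi X]row_sum_delta (functional_sum linphi) !fz//.
under eq_bigr do rewrite mxE mulrBl.
by rewrite big_split/= sumrN; lra.
Qed.

Lemma not_wclco_separation (A : set (X -> R)) (l : X -> R) :
  dual l -> ~ wclco A l ->
  exists z, exists2 d, 0 < d & forall a, A a -> a z <= l z - d.
Proof.
move=> dl nAl.
have [C [Cdual cvxC clC AC nCl]] : exists C : set (X -> R),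
    [/\ C `<=` dual, dconvex C, wstar_closed C, A `<=` C & ~ C l].
  apply: contrapT => nC; apply: nAl; split=> // C Cdual cvxC clC AC.
  by apply: contrapT => nCl; apply: nC; exists C.
have [s [e [e0 Ce]]] : exists s : seq X, exists e : R, 0 < e /\
    forall a, C a -> exists2 z, z \in s & e <= `|a z - l z|.
  apply: contrapT => nse; apply: nCl; apply: clC => // s e e0.
  apply: contrapT => nC; apply: nse; exists s, e; split=> // a Ca.
  apply: contrapT => nz; apply: nC; exists a => // z zs.
  by rewrite ltNge; apply/negP => ez; apply: nz; exists z.
have [C0|nC] := pselect (C !=set0).
  have [z zC] := dconvex_separation Cdual cvxC C0 dl e0 Ce.
  by exists z, e => // a /AC; exact: zC.
(* If [C] is empty, so is [A], and any direction separates. *)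
by exists 0, 1 => // a /AC Ca; exfalso; apply: nC; exists a.
Qed.

End separation.

(** * Compactness and convexity along a ray *)

Lemma compact_decreasing_nonempty (R : realType) (T : topologicalType)
    (B : R -> set T) : compact [set: T] ->
  (forall s, 0 < s -> closed (B s)) -> (forall s, 0 < s -> B s !=set0) ->
  (forall s s', 0 < s -> s <= s' -> B s `<=` B s') ->
  exists t, forall s, 0 < s -> B s t.
Proof.
move=> cT clB B0 decB.
(* Being nested, the [B s] form a filter base; a cluster point lies in each closed [B s]. *)
pose G := filter_from [set s : R | 0 < s] B.
have GG : ProperFilter G.
  apply: filter_from_proper => //; apply: filter_from_filter.
    by exists 1 => /=.
  move=> s s' /= s0 s'0; exists (Num.min s s'); first by rewrite /= lt_min s0.
  by move=> t Bt; split; apply: decB Bt; rewrite ?lt_min ?s0 ?ge_min ?lexx ?orbT.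
have [t [_ Gt]] := cT G GG filterT.
exists t => s s0; apply: clB => // U Ut.
by apply: Gt Ut; exists s.
Qed.

Section convex_along_ray.
Context {R : realType} {X : tvsType R}.
Implicit Types (g : X -> \bar R) (x z : X).

Lemma convex_fun_ray g x z (r q s k : R) :
  convex_fun g -> 0 <= k <= 1 ->
  (g x <= r%:E)%E -> (g (x + s *: z)%R <= q%:E)%E ->
  (g (x + (k * s) *: z)%R <= (k * q + (1 - k) * r)%:E)%E.
Proof.
move=> cvxg k01 gxr gq; have /andP[k0 k1] := k01.
have -> : x + (k * s) *: z = k *: (x + s *: z) + (1 - k) *: x.
  by rewrite scalerDr scalerA addrAC -scalerDl subrKC scale1r.
apply: le_trans (cvxg _ _ _ k01) _.
rewrite [leRHS]EFinD (EFinM k) (EFinM (1 - k)).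
by apply: leeD; apply: lee_wpmul2l; rewrite // lee_fin ?subr_ge0.
Qed.

(** As [g x <= r], the quotient (g(x + s z) - r) / s is nondecreasing in [s]. *)
Lemma convex_fun_ray_le g x z (r M s s' : R) :
  convex_fun g -> (forall y, g y != -oo%E) -> (g x <= r%:E)%E ->
  0 < s -> s <= s' -> ((r + s * M)%:E <= g (x + s *: z)%R)%E ->
  ((r + s' * M)%:E <= g (x + s' *: z)%R)%E.
Proof.
move=> cvxg gNy gx s0 ss' gs.
case gs'E : (g (x + s' *: z)) => [q| |]; last 2 first.
- by rewrite leey.
- by have := gNy (x + s' *: z); rewrite gs'E.
have s'0 : 0 < s' by exact: lt_le_trans ss'.
pose k := s / s'; have k0 : 0 < k by rewrite divr_gt0.
have sE : s = k * s' by rewrite /k divfK ?gt_eqF.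
have k01 : 0 <= k <= 1 by rewrite ltW//= ler_pdivrMr// mul1r.
have gq : (g (x + s' *: z)%R <= q%:E)%E by rewrite gs'E.
have := le_trans gs; rewrite {1}sE => /(_ _ (convex_fun_ray cvxg k01 gx gq)).
rewrite !lee_fin => H; rewrite -(ler_pM2l k0).
by move: H; rewrite sE; lra.
Qed.

(** A finite value on the ray would, by convexity, bring [g] close to [r'] near [x], below the
    minorant, which stays close to [r]. *)
Lemma convex_fun_ray_pinfty g x z (r r' M s : R) :
  convex_fun g -> (forall y, g y != -oo%E) -> g x = r'%:E -> r' < r ->
  (forall s, 0 < s -> ((r + s * M)%:E <= g (x + s *: z)%R)%E) -> 0 < s ->
  g (x + s *: z) = +oo%E.
Proof.
move=> cvxg gNy gx r'r gM s0.
case gsE : (g (x + s *: z)) => [q| |] //; last first.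
  by have := gNy (x + s *: z); rewrite gsE.
exfalso; pose K := `|q - r' - s * M|.
have K0 : 0 <= K by rewrite normr_ge0.
have den : 0 < r - r' + K + 1 by lra.
(* Chosen so that [k < 1] and [k * K < r - r']. *)
pose k := (r - r') / (r - r' + K + 1).
have k0 : 0 < k by rewrite divr_gt0// subr_gt0.
have k1 : k < 1 by rewrite ltr_pdivrMr//; lra.
have kE : k * (r - r' + K + 1) = r - r' by rewrite divfK ?gt_eqF.
have gx' : (g x <= r'%:E)%E by rewrite gx.
have gq : (g (x + s *: z)%R <= q%:E)%E by rewrite gsE.
have k01 : 0 <= k <= 1 by rewrite !ltW.
have := le_trans (gM _ (mulr_gt0 k0 s0)) (convex_fun_ray cvxg k01 gx' gq).
rewrite lee_fin => H.
have : k * (q - r' - s * M) <= k * K by rewrite ler_pM2l// ler_norm.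
have : 0 < k * (r - r') by rewrite mulr_gt0// subr_gt0.
lra.
Qed.

End convex_along_ray.

(** * Positive multiples of extended-valued functions *)

Section scaled_function.
Context {R : realType} {X : tvsType R}.
Context {g : X -> \bar R} {rho : R} (rho0 : 0 < rho).

Let h y := (rho%:E * g y)%E.

Lemma convex_fun_scale : (forall y, g y != -oo%E) -> convex_fun g -> convex_fun h.
Proof.
have NyM (k : R) u : 0 <= k -> (u != -oo -> -oo < k%:E * u)%E.
  move=> k0; case: u => [u||]//= _; first by rewrite -EFinM ltNyr.
  by apply: lt_le_trans (mule_ge0 _ _); rewrite ?ltNyr ?lee_fin ?leey.
move=> gNy cvxg y z k k01; have /andP[k0 k1] := k01.
rewrite /h (muleCA k%:E) (muleCA (1 - k)%:E) -muleDr//; last first.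
  by apply: ltninfty_adde_def; rewrite inE; apply: NyM; rewrite ?subr_ge0.
by apply: lee_wpmul2l; [rewrite lee_fin ltW|exact: cvxg].
Qed.

Lemma lsc_fun_scale : lsc_fun g -> lsc_fun h.
Proof.
move=> lscg r; have -> : [set y | (h y <= r%:E)%E] = [set y | (g y <= (r / rho)%:E)%E].
  by apply/seteqP; split=> y /=; rewrite /h mulrC EFinM lee_pdivlMl.
exact: lscg.
Qed.

End scaled_function.

(** * Weak* closed half-spaces *)

Section half_space.
Context {R : realType} {X : tvsType R}.

Lemma dual_half_space_dconvex (v : X) (b : R) :
  dconvex [set l | dual l /\ l v <= b].
Proof.
move=> a c k [[lina ca] av] [[linc cc] cv] /andP[k0 k1]; split; first split.
- by move=> m u w; rewrite lina linc; ring.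
- by move=> u; apply: cvgD; apply: cvgMr; [exact: ca|exact: cc].
- nra.
Qed.

(** The half-space is convex and weak* closed, closedness being tested at the single point [v]. *)
Lemma wclco_half_space (A : set (X -> R)) (v : X) (b : R) :
  (forall a, A a -> dual a /\ a v <= b) ->
  forall l, wclco A l -> l v <= b.
Proof.
move=> Ab l [dl Cl].
have clH : wstar_closed [set l | dual l /\ l v <= b].
  move=> m dm mcl; split => //; apply/ler_addgt0Pr => e e0.
  have [a [_ av] /(_ v)] := mcl [:: v] e e0.
  by rewrite mem_head ltr_norml => /(_ isT) /andP[+ _]; lra.
by have [] := Cl _ (fun=> @proj1 _ _) (@dual_half_space_dconvex v b) clH Ab.
Qed.

End half_space.

(** * The two inclusions for the supremum function *)

Section supremum.
Context {R : realType} {X : tvsType R} {T : topologicalType}.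
Context (F : T -> X -> \bar R) (x : X).
Context
  (FP : forall t, proper_fun (F t) /\ convex_fun (F t) /\ lsc_fun (F t)).

Lemma supf_ge t y : (F t y <= supf F y)%E.
Proof. by apply: ereal_sup_ubound; exists t. Qed.

Lemma proper_supf_fin_num t : (supf F x < +oo)%E -> F t x \is a fin_num.
Proof.
move=> fx; rewrite fin_numE (FP t).1.1 /= -ltey.
exact: le_lt_trans (supf_ge t x) fx.
Qed.

Lemma exists_ray_minorized (z : X) (r M : R) :
  compact [set: T] -> (forall z, usc_fun (fun t => F t z)) ->
  (supf F x <= r%:E)%E ->
  (forall s, 0 < s -> ((r + s * M)%:E < supf F (x + s *: z)%R)%E) ->
  exists t, forall s, 0 < s -> ((r + s * M)%:E <= F t (x + s *: z)%R)%E.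
Proof.
move=> cT uscF fr gM.
apply: (@compact_decreasing_nonempty R T
  (fun s => [set t | ((r + s * M)%:E <= F t (x + s *: z)%R)%E])) => //.
- by move=> s _; exact: uscF.
- by move=> s /gM /ereal_sup_gt [_ [t _ <-]] /ltW; exists t.
- move=> s s' s0 ss' t /=; have [[Ny _] [cvx _]] := FP t.
  by apply: convex_fun_ray_le => //; apply: le_trans fr; exact: supf_ge.
Qed.

Lemma subdiff_supf_sub_wclco (rho : T -> R) (eps : R) :
  compact [set: T] -> (forall z, usc_fun (fun t => F t z)) ->
  (supf F x < +oo)%E -> (forall t, 0 < rho t) -> 0 < eps ->
  subdiff (supf F) x `<=`
    wclco ((\bigcup_(t in active F x) esubdiff eps (F t) x) `|`
           (\bigcup_(t in ~` active F x)
               scale_set eps (esubdiff eps (fun y => (rho t)%:E * F t y)%E x))).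
Proof.
move=> cT uscF fxoo rho0 eps0 l [dl [fxfin lsub]].
apply: contrapT => /(not_wclco_separation dl) [z [d d0 Asep]].
set r := fine (supf F x); have fxE : supf F x = r%:E by rewrite fineK.
pose M := l z - d / 2.
have [t Ft] : exists t, forall s, 0 < s ->
    ((r + s * M)%:E <= F t (x + s *: z)%R)%E.
  apply: exists_ray_minorized => //; first by rewrite fxE.
  move=> s s0; have := lsub (x + s *: z); apply: lt_le_trans.
  have -> : x + s *: z - x = s *: z by rewrite addrAC subrr add0r.
  rewrite fxE (functionalZ dl.1) sube0 -EFinD lte_fin ltrD2l.
  by rewrite ltr_pM2l// /M; lra.
have [[FNy _] [cvxF lscF]] := FP t.
have Ftfin := proper_supf_fin_num t fxoo.
have [act|nact] := pselect (active F x t).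
  (* The slope [l z - d * 3 / 4] lies strictly between the separation bound [l z - d] and [M]. *)
  have [|a asub az] := @exists_esubdiff_ge R X (F t) x z eps M (l z - d * 3 / 4)
    cvxF lscF FNy Ftfin eps0 _ ltac:(rewrite /M; lra).
    by rewrite act.
  by have := Asep a (or_introl (ex_intro2 _ _ t act asub)); lra.
have Ftr : fine (F t x) < r.
  rewrite -lte_fin fineK// -fxE lt_neqAle supf_ge andbT.
  by apply/eqP => H; apply: nact.
have Foo s : 0 < s -> F t (x + s *: z) = +oo%E.
  apply: (@convex_fun_ray_pinfty _ _ _ x z r (fine (F t x)) M) => //.
  by rewrite fineK.
(* Multiplication by [eps] brings slope [M'] back to [l z], above the separation bound. The slope
   [M' + 1] is available since the scaled function is infinite on the open ray. *)
pose M' := l z / eps.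
have [|s s0||a asub az] := @exists_esubdiff_ge R X
    (fun y => (rho t)%:E * F t y)%E x z eps (M' + 1) M'
    (convex_fun_scale (rho0 t) FNy cvxF) (lsc_fun_scale (rho0 t) lscF) _
    (fin_numM (erefl : (rho t)%:E \is a fin_num) Ftfin) eps0.
- move=> y; case FtyE : (F t y) => [q||].
  + by rewrite -EFinM.
  + by rewrite gt0_muley ?lte_fin.
  + by have := FNy y; rewrite FtyE.
- by rewrite Foo// gt0_muley ?lte_fin ?leey.
- by lra.
have inA : (\bigcup_(t in ~` active F x)
  scale_set eps (esubdiff eps (fun y => (rho t)%:E * F t y)%E x))
    (fun y => eps * a y).
  by exists t => //; exists a.
have /= := Asep _ (or_intror inA).
have : l z <= eps * a z.
  by rewrite -[l z](divfK (lt0r_neq0 eps0)) mulrC ler_pM2l.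
lra.
Qed.

Lemma wclco_sub_subdiff_supf (rho : T -> R) :
  supf F x \is a fin_num ->
  (forall t, 0 < rho t <= 1) ->
  (-oo < ereal_inf [set (rho t)%:E * F t x | t in [set: T]])%E ->
  (forall y, (supf F x <= supf F y)%E) ->
  \bigcap_(eps in [set e : R | 0 < e])
    wclco ((\bigcup_(t in active F x) esubdiff eps (F t) x) `|`
           (\bigcup_(t in ~` active F x)
               scale_set eps (esubdiff eps (fun y => (rho t)%:E * F t y)%E x)))
  `<=` subdiff (supf F) x.
Proof.
move=> fxfin rho01 infF minx l lK.
have fxoo : (supf F x < +oo)%E by rewrite ltey_eq fxfin.
have [m Fm] : exists m : R, forall t, m <= rho t * fine (F t x).
  have infle t : (ereal_inf [set (rho t)%:E * F t x | t in [set: T]] <=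
      (rho t * fine (F t x))%:E)%E.
    apply: ereal_inf_lbound; exists t => //.
    by rewrite EFinM fineK// proper_supf_fin_num.
  case: ereal_inf infF infle => [m _ H|_ H|//].
    by exists m => t; rewrite -lee_fin.
  (* The value 0 is a dummy: an infimum [+oo] is incompatible with any index [t]. *)
  by exists 0 => t; have := H t.
set r := fine (supf F x); have fxE : supf F x = r%:E by rewrite fineK.
have [dl _] := lK 1 ltr01.
split=> //; split => // y; rewrite fxE sube0.
case fyE : (supf F y) => [q| |]; last 2 first.
- by rewrite leey.
- by have := minx y; rewrite fyE fxE.
have rq : r <= q by have := minx y; rewrite fyE fxE.
rewrite -EFinD lee_fin -lerBrDl; apply/ler_addgt0Pr => e e0.
(* [c] exceeds both 1, for the error [eps] of active indices, and [|q| - m + eps], the bound for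
   inactive ones. *)
pose c := `|q| + `|m| + 2.
have c0 : 0 < c by have := normr_ge0 q; have := normr_ge0 m; rewrite /c; lra.
pose eps := Num.min 1 (e / c).
have eps0 : 0 < eps by rewrite lt_min ltr01 divr_gt0.
have eps1 : eps <= 1 by rewrite ge_min lexx.
have epsc : eps * c <= e by rewrite -ler_pdivlMr// ge_min lexx orbT.
apply: (wclco_half_space _ (lK _ eps0)) => a [[t act [da [_ asub]]]|].
  split => //; have := asub y; rewrite act fxE.
  move=> /le_trans /(_ (supf_ge t y)); rewrite fyE -!EFinD lee_fin.
  have : eps * 1 <= eps * c.
    by rewrite ler_pM2l// /c; have := normr_ge0 q; have := normr_ge0 m; lra.
  lra.
move=> [t _ [b [[linb cb] [_ bsub]] <-]]; split.
  split; first by move=> k u v; rewrite linb; ring.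
  by move=> u; apply: cvgMr; exact: cb.
have [/andP[rho0 rho1]] := rho01 t.
have Ftfin := proper_supf_fin_num t fxoo.
(* Here [rho t <= 1] gives the bound [|q|] at [y], and [m] bounds the scaled value at [x] from
   below. *)
have by_ : b (y - x) <= `|q| - m + eps.
  have := bsub y; rewrite -(fineK Ftfin) -EFinM -!EFinD => H.
  have : ((rho t)%:E * F t y <= `|q|%:E)%E.
    have Fq := supf_ge t y; rewrite fyE in Fq.
    apply: (@le_trans _ _ ((rho t)%:E * q%:E)%E).
      by apply: lee_wpmul2l => //; rewrite lee_fin ltW.
    rewrite -EFinM lee_fin; apply: le_trans (ler_norm _) _.
    by rewrite normrM gtr0_norm// ler_piMl.
  move=> /(le_trans H); rewrite lee_fin; have := Fm t; lra.
(* The right side is at most [e], hence at most [q - r + e], because minimality gives [r <= q]. *)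
have : eps * b (y - x) <= eps * c.
  rewrite ler_pM2l//; apply: le_trans by_ _.
  have := ler_norm (- m); rewrite normrN /c; lra.
lra.
Qed.

End supremum.

(** * The inclusion and the case of a minimum *)

Theorem theorem2 (R : realType) (X : tvsType R) (T : topologicalType)
  (F : T -> X -> \bar R) (x : X) (rho : T -> R) :
  hausdorff_space X ->
  [set: T] !=set0 ->
  (forall t, proper_fun (F t) /\ convex_fun (F t) /\ lsc_fun (F t)) ->
  (* (SH) *)
  compact [set: T] -> hausdorff_space T ->
  (forall z, usc_fun (fun t => F t z)) ->
  (* x in dom f *)
  (supf F x < +oo)%E ->
  (forall t, 0 < rho t <= 1) ->
  (-oo < ereal_inf [set (rho t)%:E * F t x | t in [set: T]])%E ->
  let K := \bigcap_(eps in [set e : R | 0 < e])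
      wclco ((\bigcup_(t in active F x) esubdiff eps (F t) x) `|`
             (\bigcup_(t in ~` active F x)
                 scale_set eps (esubdiff eps (fun y => (rho t)%:E * F t y)%E x))) in
  subdiff (supf F) x `<=` K /\
  ((forall y, (supf F x <= supf F y)%E) -> subdiff (supf F) x = K).
Proof.
move=> _ [t0 _] FP cT _ uscF fxoo rho01 infF K.
have rho0 t : 0 < rho t by have /andP[] := rho01 t.
have subK : subdiff (supf F) x `<=` K.
  by move=> l lf eps eps0; exact: subdiff_supf_sub_wclco.
split=> // minx; apply/seteqP; split=> //.
apply: wclco_sub_subdiff_supf => //.
rewrite fin_numE -ltey fxoo andbT -ltNye.
by apply: lt_le_trans (supf_ge F t0 x); rewrite ltNye (FP t0).1.1.
Qed.
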